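(* Let $\mathbb F$ be a field of characteristic $0$, let $\mathcal A$ be a central unital $\mathbb F$-algebra, and let $\underline x=\{x_1,\dots,x_g\}$ be a finite alphabet. A generalized series $S\in\mathcal A\langle\!\langle\underline x\rangle\!\rangle$ is rational if and only if it is recognizable.
   Context: $\langle\underline x\rangle$ is the free monoid of words in the freely noncommuting letters $x_1,\dots,x_g$, with empty word $1$ and length $|w|$. The algebra of generalized polynomials is the free product of unital $\mathbb F$-algebras $\mathcal A\langle\underline x\rangle=\mathcal A*_{\mathbb F}\mathbb F\langle\underline x\rangle$; the algebra of generalized series $\mathcal A\langle\!\langle\underline x\rangle\!\rangle$ is its completion in the $(\underline x)$-adic topology. For $w=w_1\cdots w_\ell\in\langle\underline x\rangle$, $\mathcal A^w\subset\mathcal A\langle\underline x\rangle$ is the $\mathbb F$-span of all $a_0w_1a_1w_2\cdots w_\ell a_\ell$ with $a_i\in\mathcal A$ (so $\mathcal A^1=\mathcal A$, and $\mathcal A^x$ is the $\mathcal A$-bimodule generated by the letter $x$). Every series is uniquely $S=\sum_w[S,w]$ with $[S,w]\in\mathcal A^w$. Rational operations in $\mathcal A\langle\!\langle\underline x\rangle\!\rangle$ are the sum, the product and the inverse (of invertible elements). A series is rational if it belongs to the rational closure of $\mathcal A\langle\underline x\rangle$ in $\mathcal A\langle\!\langle\underline x\rangle\!\rangle$, i.e. the smallest subset containing $\mathcal A\langle\underline x\rangle$ and closed under rational operations. A series $S$ is recognizable if for some $n$ there exist $\mathbf c\in\mathcal A^{1\times n}$, $\mathbf b\in\mathcal A^{n\times1}$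 and $A^x\in(\mathcal A^x)^{n\times n}$ for $x\in\underline x$ such that $[S,w]=\mathbf cA^w\mathbf b$ for all $w\in\langle\underline x\rangle$, where $A^w=A^{w_1}\cdots A^{w_{|w|}}$ (and $A^1=I$). *)

(* Defs.v *)
From HB Require Import structures.
From mathcomp Require Import all_boot all_order all_algebra.
From mathcomp Require Import finmap.
From mathcomp.multinomials Require Import monalg.
From mathcomp Require Import boolp.

Set Implicit Arguments.
Unset Strict Implicit.
Unset Printing Implicit Defensive.

Import GRing.Theory.
Local Open Scope ring_scope.

Definition central (F : fieldType) (A : algType F) : Prop :=
  forall a : A, (forall b, a * b = b * a) -> exists k : F, a = k%:A.

Inductive lspan (F : fieldType) (V : lmodType F) (P : V -> Prop) : V -> Prop :=
| lspan0 : lspan P 0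
| lspanZD k u v : P u -> lspan P v -> lspan P (k *: u + v).

Section LinearSpan.
Variables (F : fieldType) (V : lmodType F) (P : V -> Prop).

Lemma lspan_in u : P u -> lspan P u.
Proof. by move=> Pu; rewrite -[u]scale1r -[_ *: _]addr0; do !constructor. Qed.

Lemma lspanD u v : lspan P u -> lspan P v -> lspan P (u + v).
Proof.
move=> Pu Pv; elim: Pu => [|k x y Px _ IH]; first by rewrite add0r.
by rewrite -addrA; constructor.
Qed.

Lemma lspanZ k u : lspan P u -> lspan P (k *: u).
Proof.
elim=> [|l x y Px _ IH]; first by rewrite scaler0; constructor.
by rewrite scalerDr scalerA; constructor.
Qed.

Lemma lspan_sum I (r : seq I) (f : I -> V) :
  (forall i, lspan P (f i)) -> lspan P (\sum_(i <- r) f i).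
Proof. by move=> Pf; apply: big_ind => //; [constructor | apply: lspanD]. Qed.

End LinearSpan.

(* The free product of A and B is built as formal expressions in elements of A
   and B, two expressions being identified when they take the same value in
   every F-algebra C, for every pair of algebra morphisms A -> C and B -> C. *)
Section FreeProduct.
Variables (F : fieldType) (A B : algType F).

Inductive fpterm : Type :=
| TInl of A
| TInr of B
| TAdd of fpterm & fpterm
| TMul of fpterm & fpterm.

HB.instance Definition _ := gen_eqMixin fpterm.
HB.instance Definition _ := gen_choiceMixin fpterm.

Section Eval.
Variables (C : algType F) (f : {lrmorphism A -> C}) (h : {lrmorphism B -> C}).

Fixpoint fpeval (t : fpterm) : C :=
  match t with
  | TInl a => f a
  | TInr b => h b
  | TAdd t u => fpeval t + fpeval u
  | TMul t u => fpeval t * fpeval u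
  end.

End Eval.

Definition fpeq : rel fpterm := fun t u =>
  `[< forall (C : algType F) (f : {lrmorphism A -> C}) (h : {lrmorphism B -> C}),
        fpeval f h t = fpeval f h u >].

Lemma fpeq_refl : reflexive fpeq.
Proof. by move=> t; apply/asboolP. Qed.

Lemma fpeq_sym : symmetric fpeq.
Proof. by move=> t u; apply/asboolP/asboolP => e C f h; rewrite e. Qed.

Lemma fpeq_trans : transitive fpeq.
Proof.
move=> u t v /asboolP e1 /asboolP e2; apply/asboolP => C f h.
by rewrite e1 e2.
Qed.

Canonical fpeq_equiv := EquivRel fpeq fpeq_refl fpeq_sym fpeq_trans.

Definition freeprod : Type := {eq_quot fpeq}%qT.
HB.instance Definition _ := Choice.on freeprod.
HB.instance Definition _ := EqQuotient.on freeprod.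

Definition fpi (t : fpterm) : freeprod := (\pi_freeprod t)%qT.

Definition fp_inl (a : A) : freeprod := fpi (TInl a).
Definition fp_inr (b : B) : freeprod := fpi (TInr b).
Definition fp_add (x y : freeprod) := fpi (TAdd (repr x) (repr y)).
Definition fp_mul (x y : freeprod) := fpi (TMul (repr x) (repr y)).
Definition fp_scale (k : F) (x : freeprod) := fp_mul (fp_inl k%:A) x.

Definition fp_lift (C : algType F) (f : {lrmorphism A -> C})
  (h : {lrmorphism B -> C}) (x : freeprod) : C := fpeval f h (repr x).

Section Lift.
Variables (C : algType F) (f : {lrmorphism A -> C}) (h : {lrmorphism B -> C}).
Local Notation lift := (fp_lift f h).

Lemma fp_lift_pi t : lift (fpi t) = fpeval f h t.
Proof.
rewrite /fp_lift /fpi.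
have /eqmodP/asboolP e : (repr (\pi_freeprod t) = t %[mod freeprod])%qT.
  by rewrite reprK.
exact: e.
Qed.

Lemma fp_lift_inl a : lift (fp_inl a) = f a.
Proof. exact: fp_lift_pi. Qed.
Lemma fp_lift_inr b : lift (fp_inr b) = h b.
Proof. exact: fp_lift_pi. Qed.
Lemma fp_lift_add x y : lift (fp_add x y) = lift x + lift y.
Proof. exact: fp_lift_pi. Qed.
Lemma fp_lift_mul x y : lift (fp_mul x y) = lift x * lift y.
Proof. exact: fp_lift_pi. Qed.
Lemma fp_lift_scale k x : lift (fp_scale k x) = k *: lift x.
Proof. by rewrite fp_lift_mul fp_lift_inl rmorph_alg mulr_algl. Qed.

Definition fp_liftE :=
  (fp_lift_inl, fp_lift_inr, fp_lift_add, fp_lift_mul, fp_lift_scale).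
End Lift.

Lemma fp_ext (x y : freeprod) :
  (forall (C : algType F) (f : {lrmorphism A -> C}) (h : {lrmorphism B -> C}),
     fp_lift f h x = fp_lift f h y) -> x = y.
Proof.
move=> e; rewrite -[x]reprK -[y]reprK; apply/eqmodP/asboolP => C f h.
exact: e.
Qed.

Lemma fp_addA : associative fp_add.
Proof. by move=> x y z; apply: fp_ext => C f h; rewrite !fp_liftE addrA. Qed.
Lemma fp_addC : commutative fp_add.
Proof. by move=> x y; apply: fp_ext => C f h; rewrite !fp_liftE addrC. Qed.
Lemma fp_add0 : left_id (fp_inl 0) fp_add.
Proof. by move=> x; apply: fp_ext => C f h; rewrite !fp_liftE raddf0 add0r. Qed.
Lemma fp_addN : left_inverse (fp_inl 0) (fp_scale (-1)) fp_add.
Proof.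
by move=> x; apply: fp_ext => C f h; rewrite !fp_liftE raddf0 scaleN1r addNr.
Qed.
HB.instance Definition _ :=
  GRing.isZmodule.Build freeprod fp_addA fp_addC fp_add0 fp_addN.

Lemma fp_mulA : associative fp_mul.
Proof. by move=> x y z; apply: fp_ext => C f h; rewrite !fp_liftE mulrA. Qed.
Lemma fp_mul1r : left_id (fp_inl 1) fp_mul.
Proof. by move=> x; apply: fp_ext => C f h; rewrite !fp_liftE rmorph1 mul1r. Qed.
Lemma fp_mulr1 : right_id (fp_inl 1) fp_mul.
Proof. by move=> x; apply: fp_ext => C f h; rewrite !fp_liftE rmorph1 mulr1. Qed.
Lemma fp_mulDl : left_distributive fp_mul +%R.
Proof. by move=> x y z; apply: fp_ext => C f h; rewrite !fp_liftE mulrDl. Qed.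
Lemma fp_mulDr : right_distributive fp_mul +%R.
Proof. by move=> x y z; apply: fp_ext => C f h; rewrite !fp_liftE mulrDr. Qed.
HB.instance Definition _ :=
  GRing.Zmodule_isPzRing.Build freeprod fp_mulA fp_mul1r fp_mulr1 fp_mulDl fp_mulDr.

Lemma fp_scaleA a b x : fp_scale a (fp_scale b x) = fp_scale (a * b) x.
Proof. by apply: fp_ext => C f h; rewrite !fp_liftE scalerA. Qed.
Lemma fp_scale1 : left_id 1 fp_scale.
Proof. by move=> x; apply: fp_ext => C f h; rewrite !fp_liftE scale1r. Qed.
Lemma fp_scaleDr : right_distributive fp_scale +%R.
Proof. by move=> k x y; apply: fp_ext => C f h; rewrite !fp_liftE scalerDr. Qed.
Lemma fp_scaleDl x : {morph fp_scale^~ x : a b / a + b}.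
Proof. by move=> a b; apply: fp_ext => C f h; rewrite !fp_liftE scalerDl. Qed.
HB.instance Definition _ :=
  GRing.Zmodule_isLmodule.Build F freeprod fp_scaleA fp_scale1 fp_scaleDr fp_scaleDl.

Lemma fp_scaleAl k x y :
  fp_scale k (fp_mul x y) = fp_mul (fp_scale k x) y.
Proof. by apply: fp_ext => C f h; rewrite !fp_liftE scalerAl. Qed.
Lemma fp_scaleAr k x y :
  fp_scale k (fp_mul x y) = fp_mul x (fp_scale k y).
Proof. by apply: fp_ext => C f h; rewrite !fp_liftE scalerAr. Qed.

End FreeProduct.

Definition freealg (F : fieldType) (g : nat) : Type := {malg F[{fmonom 'I_g}]}.
HB.instance Definition _ F g := GRing.Lalgebra.on (freealg F g).

Section FreeAlgebra.
Variables (F : fieldType) (g : nat).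

Lemma freealg_scaleAr (k : F) (p q : freealg F g) : k *: (p * q) = p * (k *: q).
Proof.
apply/malgP => m.
rewrite [LHS](mcoeffZ k (p * q : {malg F[{fmonom 'I_g}]})).
rewrite (mcoeffMlw m (fsubset_refl (msupp p)) (fsubset_refl (msupp q))).
rewrite [RHS](mcoeffMlw m (fsubset_refl (msupp p)) (msuppZ_le k q)).
rewrite big_distrr; apply: eq_bigr => k1 _; rewrite big_distrr.
apply: eq_bigr => k2 _.
by rewrite mcoeffZ /= mulrCA; exact: mulrnAr.
Qed.
HB.instance Definition _ :=
  GRing.Lalgebra_isAlgebra.Build F (freealg F g) freealg_scaleAr.


Definition faletter (i : 'I_g) : freealg F g := << fmu i >>.

Section Lift.
Variables (C : algType F) (z : 'I_g -> C).

Definition fmonom_prod (m : {fmonom 'I_g}) : C := \prod_(i <- m) z i.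

Lemma fmonom_prod_morph : mmorphism fmonom_prod.
Proof.
by split=> [m1 m2|]; rewrite /fmonom_prod ?fm1 ?big_nil // fmM big_cat.
Qed.
HB.instance Definition _ :=
  isMultiplicative.Build {fmonom 'I_g} C fmonom_prod fmonom_prod_morph.

Definition freealg_lift (p : freealg F g) : C := mmap (in_alg C) fmonom_prod p.

Lemma freealg_lift_additive : additive freealg_lift.
Proof. exact: (raddfB (mmap (in_alg C) fmonom_prod)). Qed.
HB.instance Definition _ :=
  GRing.isAdditive.Build (freealg F g) C freealg_lift freealg_lift_additive.

Lemma freealg_lift_mul : monoid_morphism freealg_lift.
Proof.
have [] := @commr_mmap_is_multiplicative {fmonom 'I_g} F C (in_alg C) fmonom_prod.
  by move=> p m m'; rewrite /GRing.comm mulr_algl mulr_algr.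
by [].
Qed.
HB.instance Definition _ :=
  GRing.isMonoidMorphism.Build (freealg F g) C freealg_lift freealg_lift_mul.

Lemma freealg_lift_scale : scalable freealg_lift.
Proof. by move=> k p; rewrite /freealg_lift mmapZ mulr_algl. Qed.
HB.instance Definition _ :=
  GRing.isScalable.Build F (freealg F g) C *:%R freealg_lift freealg_lift_scale.

Lemma freealg_lift_letter i : freealg_lift (faletter i) = z i.
Proof.
by rewrite /freealg_lift mmapU /= scale1r mul1r /fmonom_prod fmU big_seq1.
Qed.

End Lift.

Lemma freealg_ind_mon (P : freealg F g -> Prop) :
  P 0 -> (forall p q, P p -> P q -> P (p + q)) ->
  (forall (k : F) (w : seq 'I_g), P (k *: \prod_(i <- w) faletter i)) ->
  forall p, P p.
Proof.
move=> P0 PD PM p; rewrite [p]monalgE.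
apply: big_ind => // m _.
suff -> : << p@_m *g m >> = p@_m *: \prod_(i <- m) faletter i by apply: PM.
have -> : \prod_(i <- m) faletter i = << m >>.
  rewrite -[in RHS](fmK m); elim: (fmonom_val m) => [|i w IH].
    by rewrite big_nil -fmoneE.
  rewrite big_cons IH /faletter malgME !msuppU1 !big_seq_fset1 !mcoeffUU mul1r.
  by congr << _ >>; apply/eqP; rewrite fmP fmM fmU.
by apply/malgP=> l; rewrite mcoeffZ !mcoeffU mulrnAr mulr1.
Qed.

End FreeAlgebra.

(* A<x>, the free product over F of A and of the free algebra F<x>. *)
Definition genpoly (F : fieldType) (A : algType F) (g : nat) : Type :=
  freeprod A (freealg F g).
HB.instance Definition _ F A g := GRing.Lmodule.on (@genpoly F A g).
HB.instance Definition _ F A g := GRing.PzRing.on (@genpoly F A g).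

Section GenPoly.
Variables (F : fieldType) (A : algType F) (g : nat).
Local Notation P := (genpoly A g).

Lemma genpoly_1neq0 : (1 : P) != 0.
Proof.
apply/eqP => e.
have := congr1 (fp_lift (idfun : {lrmorphism A -> A})
  (freealg_lift (fun=> 0) : {lrmorphism freealg F g -> A})) e.
by rewrite !fp_lift_inl => /eqP; rewrite oner_eq0.
Qed.
HB.instance Definition _ := GRing.PzSemiRing_isNonZero.Build P genpoly_1neq0.
HB.instance Definition _ :=
  GRing.Lmodule_isLalgebra.Build F P (@fp_scaleAl F A (freealg F g)).
HB.instance Definition _ :=
  GRing.Lalgebra_isAlgebra.Build F P (@fp_scaleAr F A (freealg F g)).

Definition gconst (a : A) : P := fp_inl (freealg F g) a.
Definition gletter (i : 'I_g) : P := fp_inr A (faletter F i).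

Lemma gconst_additive : additive gconst.
Proof.
move=> a b; apply: fp_ext => C f h.
by rewrite fp_lift_add fp_lift_scale !fp_lift_inl raddfB scaleN1r.
Qed.
HB.instance Definition _ := GRing.isAdditive.Build A P gconst gconst_additive.
Lemma gconst_mul : monoid_morphism gconst.
Proof.
split=> // a b; apply: fp_ext => C f h.
by rewrite fp_lift_mul !fp_lift_inl rmorphM.
Qed.
HB.instance Definition _ := GRing.isMonoidMorphism.Build A P gconst gconst_mul.
Lemma gconst_scale : scalable gconst.
Proof.
move=> k a; apply: fp_ext => C f h.
by rewrite fp_lift_scale !fp_lift_inl linearZ.
Qed.
HB.instance Definition _ := GRing.isScalable.Build F A P *:%R gconst gconst_scale.

Section Lift.
Variables (C : algType F) (f : {lrmorphism A -> C}) (z : 'I_g -> C).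

Definition genpoly_lift (p : P) : C := fp_lift f (freealg_lift z) p.

Lemma genpoly_lift_additive : additive genpoly_lift.
Proof.
move=> p q; rewrite /genpoly_lift [LHS]fp_lift_add.
by rewrite fp_lift_scale scaleN1r.
Qed.
HB.instance Definition _ :=
  GRing.isAdditive.Build P C genpoly_lift genpoly_lift_additive.
Lemma genpoly_lift_mul : monoid_morphism genpoly_lift.
Proof.
split; first by rewrite /genpoly_lift fp_lift_inl rmorph1.
by move=> p q; apply: fp_lift_mul.
Qed.
HB.instance Definition _ :=
  GRing.isMonoidMorphism.Build P C genpoly_lift genpoly_lift_mul.
Lemma genpoly_lift_scale : scalable genpoly_lift.
Proof. by move=> k p; apply: fp_lift_scale. Qed.
HB.instance Definition _ :=
  GRing.isScalable.Build F P C *:%R genpoly_lift genpoly_lift_scale.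

Lemma genpoly_lift_const a : genpoly_lift (gconst a) = f a.
Proof. exact: fp_lift_inl. Qed.
Lemma genpoly_lift_letter i : genpoly_lift (gletter i) = z i.
Proof. by rewrite [LHS]fp_lift_inr; exact: freealg_lift_letter. Qed.
End Lift.

Lemma genpoly_ind (Q : P -> Prop) :
  (forall a, Q (gconst a)) -> (forall i, Q (gletter i)) ->
  (forall p q, Q p -> Q q -> Q (p + q)) ->
  (forall p q, Q p -> Q q -> Q (p * q)) -> forall p, Q p.
Proof.
move=> Qc Ql QD QM p; rewrite -[p]reprK.
have piD t u : fpi (TAdd t u) = (fpi t : P) + fpi u.
  by apply: fp_ext => C f h; rewrite fp_lift_add !fp_lift_pi.
have piM t u : fpi (TMul t u) = (fpi t : P) * fpi u.
  by apply: fp_ext => C f h; rewrite fp_lift_mul !fp_lift_pi.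
rewrite -/(fpi _); elim: (repr p) => [a|b|t IHt u IHu|t IHt u IHu].
- exact: Qc.
- elim/freealg_ind_mon: b => [|b c IHb IHc|k w].
  + suff -> : fpi (TInr A 0) = gconst 0 by apply: Qc.
    by apply: fp_ext => C f h; rewrite fp_lift_pi fp_lift_inl /= !raddf0.
  + suff -> : fpi (TInr A (b + c)) = (fpi (TInr A b) : P) + fpi (TInr A c).
      exact: QD.
    by apply: fp_ext => C f h; rewrite fp_lift_add !fp_lift_pi /= raddfD.
  + elim: w k => [|i w IH] k.
      suff -> : fpi (TInr A (k *: \prod_(i <- [::]) faletter F i)) = gconst k%:A.
        exact: Qc.
      apply: fp_ext => C f h.
      by rewrite fp_lift_pi fp_lift_inl /= big_nil !linearZ !rmorph1.
    suff -> : fpi (TInr A (k *: \prod_(j <- i :: w) faletter F j)) =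
        gletter i * fpi (TInr A (k *: \prod_(j <- w) faletter F j)).
      exact: QM.
    apply: fp_ext => C f h.
    by rewrite fp_lift_mul fp_lift_inr !fp_lift_pi /= big_cons scalerAr rmorphM.
- by rewrite piD; apply: QD.
- by rewrite piM; apply: QM.
Qed.

(* a0 w1 a1 w2 ... wl al, where s lists the pairs (wj, aj). *)
Fixpoint gmonom (a0 : A) (s : seq ('I_g * A)) : P :=
  if s is (i, a1) :: s' then gconst a0 * gletter i * gmonom a1 s' else gconst a0.

(* A^w, as a subspace of A<x>. *)
Definition gcomp (w : seq 'I_g) : P -> Prop :=
  lspan (fun m => exists a0 s, unzip1 s = w /\ m = gmonom a0 s).

Lemma gmonom_mulr a0 s b : exists c0 s',
  unzip1 s' = unzip1 s /\ gmonom a0 s * gconst b = gmonom c0 s'.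
Proof.
elim: s a0 => [|[i a1] s IH] a0 /=.
  by exists (a0 * b), [::]; rewrite /= rmorphM.
have [c0 [s' [<- e]]] := IH a1; exists a0, ((i, c0) :: s').
by rewrite /= -mulrA e.
Qed.

Lemma gmonom_cat a0 s b0 t : exists c0 s',
  unzip1 s' = unzip1 s ++ unzip1 t /\ gmonom a0 s * gmonom b0 t = gmonom c0 s'.
Proof.
elim: s a0 => [|[i a1] s IH] a0 /=.
  case: t => [|[j b1] t] /=.
    by exists (a0 * b0), [::]; rewrite /= rmorphM.
  by exists (a0 * b0), ((j, b1) :: t); rewrite /= rmorphM !mulrA.
have [c0 [s' [<- e]]] := IH a1; exists a0, ((i, c0) :: s').
by rewrite /= -mulrA e.
Qed.

Lemma gcomp_mul u v p q : gcomp u p -> gcomp v q -> gcomp (u ++ v) (p * q).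
Proof.
move=> Hp Hq; elim: Hp => [|k x y [a0 [s [<- ->]]] _ IH].
  by rewrite mul0r; constructor.
rewrite mulrDl -scalerAl; apply: lspanD => //; apply: lspanZ.
elim: Hq {IH} => [|l z y' [b0 [t [<- ->]]] _ IH].
  by rewrite mulr0; constructor.
rewrite mulrDr -scalerAr; apply: lspanD => //; apply: lspanZ.
apply: lspan_in; have [c0 [s' [e ->]]] := gmonom_cat a0 s b0 t.
by exists c0, s'.
Qed.

Lemma gcomp_const a : gcomp [::] (gconst a).
Proof. by apply: lspan_in; exists a, [::]. Qed.

Lemma gcomp_letter i : gcomp [:: i] (gletter i).
Proof.
apply: lspan_in; exists 1, [:: (i, 1)]; split=> //=.
by rewrite rmorph1 mul1r mulr1.
Qed.

End GenPoly.

(* A<x> is the direct sum of the A^w (see poly_series_decomp and poly_series_inj),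
   and the n-th power of the ideal generated by the letters is the sum of the A^w
   with |w| >= n, so the completion of A<x> is the product of the A^w: a series S
   is the family of its components [S, w], here S w. *)
Record genseries (F : fieldType) (A : algType F) (g : nat) := GenSeries {
  scoef :> seq 'I_g -> genpoly A g;
  scoefP : forall w, gcomp w (scoef w) }.

Section GenSeries.
Variables (F : fieldType) (A : algType F) (g : nat).
Local Notation P := (genpoly A g).
Local Notation word := (seq 'I_g).
Local Notation series := (genseries A g).
Implicit Types (w : word) (S T : series).

HB.instance Definition _ := gen_eqMixin series.
HB.instance Definition _ := gen_choiceMixin series.

Lemma series_ext S T : (forall w, S w = T w) -> S = T.
Proof.
case: S T => [S HS] [T HT] /= /funext e; case: _ / e in HT *.
by congr GenSeries; apply: Prop_irrelevance.
Qed.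

Definition conv (f h : word -> P) w : P :=
  \sum_(i < (size w).+1) f (take i w) * h (drop i w).

Lemma conv_nil f h : conv f h [::] = f [::] * h [::].
Proof. by rewrite /conv big_ord1. Qed.

Lemma conv_cons f h x w :
  conv f h (x :: w) = f [::] * h (x :: w) + conv (f \o cons x) h w.
Proof. by rewrite /conv big_ord_recl /=. Qed.

Lemma convA f h k w : conv f (conv h k) w = conv (conv f h) k w.
Proof.
elim: w f h => [|x w IH] f h; first by rewrite !conv_nil mulrA.
rewrite !conv_cons IH conv_nil mulrDr mulrA -addrA; congr (_ + _).
have -> : conv f h \o cons x =
    fun v => f [::] * (h \o cons x) v + conv (f \o cons x) h v.
  by apply/funext => v /=; rewrite conv_cons.
rewrite /conv mulr_sumr -big_split; apply: eq_bigr => i _ /=.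
by rewrite mulrDl mulrA.
Qed.

Lemma scoef_zeroP w : gcomp w (0 : P). Proof. by constructor. Qed.
Lemma scoef_addP S T w : gcomp w (S w + T w).
Proof. by apply: lspanD; apply: scoefP. Qed.
Lemma scoef_scaleP (k : F) S w : gcomp w (k *: S w).
Proof. by apply: lspanZ; apply: scoefP. Qed.
Lemma scoef_mulP S T w : gcomp w (conv S T w).
Proof.
apply: lspan_sum => i.
by have := gcomp_mul (scoefP S (take i w)) (scoefP T (drop i w)); rewrite cat_take_drop.
Qed.
Lemma scoef_constP (a : A) w : gcomp w (if w is [::] then gconst g a else 0).
Proof. by case: w => [|i w]; [apply: gcomp_const | constructor]. Qed.
Lemma scoef_letterP (i : 'I_g) w : gcomp w (if w == [:: i] then gletter A i else 0).
Proof. by case: eqP => [->|_]; [apply: gcomp_letter | constructor]. Qed.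

Definition szero : series := GenSeries scoef_zeroP.
Definition sadd S T : series := GenSeries (scoef_addP S T).
Definition sscale k S : series := GenSeries (scoef_scaleP k S).
Definition smul S T : series := GenSeries (scoef_mulP S T).
Definition sconst a : series := GenSeries (scoef_constP a).
Definition sletter i : series := GenSeries (scoef_letterP i).

Lemma saddA : associative sadd.
Proof. by move=> S T U; apply: series_ext => w; apply: addrA. Qed.
Lemma saddC : commutative sadd.
Proof. by move=> S T; apply: series_ext => w; apply: addrC. Qed.
Lemma sadd0 : left_id szero sadd.
Proof. by move=> S; apply: series_ext => w; apply: add0r. Qed.
Lemma saddN : left_inverse szero (sscale (-1)) sadd.
Proof.
by move=> S; apply: series_ext => w /=; rewrite scaleN1r addNr.
Qed.
HB.instance Definition _ := GRing.isZmodule.Build series saddA saddC sadd0 saddN.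

Lemma conv_const a (f : word -> P) w : conv (sconst a) f w = gconst g a * f w.
Proof.
case: w => [|x w]; rewrite ?conv_nil ?conv_cons //.
by rewrite /conv big1 ?addr0 // => i _; rewrite mul0r.
Qed.

Lemma smulA : associative smul.
Proof. by move=> S T U; apply: series_ext => w; apply: convA. Qed.
Lemma smul1r : left_id (sconst 1) smul.
Proof.
by move=> S; apply: series_ext => w; rewrite [LHS]conv_const rmorph1 mul1r.
Qed.
Lemma smulr1 : right_id (sconst 1) smul.
Proof.
move=> S; apply: series_ext => w /=; rewrite /conv big_ord_recr /=.
rewrite take_size drop_size rmorph1 mulr1 big1 ?add0r // => i _.
case e: (drop i w) => [|j v]; last by rewrite mulr0.
by move: (ltn_ord i); rewrite -subn_gt0 -size_drop e.
Qed.
Lemma smulDl : left_distributive smul +%R.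
Proof.
move=> S T U; apply: series_ext => w /=.
by rewrite /conv -big_split; apply: eq_bigr => i _; rewrite /= mulrDl.
Qed.
Lemma smulDr : right_distributive smul +%R.
Proof.
move=> S T U; apply: series_ext => w /=.
by rewrite /conv -big_split; apply: eq_bigr => i _; rewrite /= mulrDr.
Qed.
Lemma sone_neq0 : sconst 1 != 0.
Proof.
apply/eqP => /(congr1 (fun S => scoef S [::])) /= /eqP.
by rewrite rmorph1 oner_eq0.
Qed.
HB.instance Definition _ := GRing.Zmodule_isNzRing.Build series
  smulA smul1r smulr1 smulDl smulDr sone_neq0.

Lemma sscaleA a b S : sscale a (sscale b S) = sscale (a * b) S.
Proof. by apply: series_ext => w; apply: scalerA. Qed.
Lemma sscale1 : left_id 1 sscale.
Proof. by move=> S; apply: series_ext => w; apply: scale1r. Qed.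
Lemma sscaleDr : right_distributive sscale +%R.
Proof. by move=> k S T; apply: series_ext => w; apply: scalerDr. Qed.
Lemma sscaleDl S : {morph sscale^~ S : a b / a + b}.
Proof. by move=> a b; apply: series_ext => w; apply: scalerDl. Qed.
HB.instance Definition _ := GRing.Zmodule_isLmodule.Build F series
  sscaleA sscale1 sscaleDr sscaleDl.

Lemma sscaleAl (k : F) S T : k *: (S * T) = (k *: S) * T.
Proof.
apply: series_ext => w /=; rewrite /conv scaler_sumr.
by apply: eq_bigr => i _; rewrite /= scalerAl.
Qed.
HB.instance Definition _ := GRing.Lmodule_isLalgebra.Build F series sscaleAl.
Lemma sscaleAr (k : F) S T : k *: (S * T) = S * (k *: T).
Proof.
apply: series_ext => w /=; rewrite /conv scaler_sumr.
by apply: eq_bigr => i _; rewrite /= scalerAr.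
Qed.
HB.instance Definition _ := GRing.Lalgebra_isAlgebra.Build F series sscaleAr.

Lemma sconst_additive : additive sconst.
Proof.
move=> a b; apply: series_ext => -[|i w] /=.
  by rewrite raddfB scaleN1r.
by rewrite scaler0 addr0.
Qed.
HB.instance Definition _ := GRing.isAdditive.Build A series sconst sconst_additive.
Lemma sconst_mul : monoid_morphism sconst.
Proof.
split=> // a b; apply: series_ext => w; rewrite [RHS]conv_const.
by case: w => [|i w] /=; rewrite ?rmorphM ?mulr0.
Qed.
HB.instance Definition _ :=
  GRing.isMonoidMorphism.Build A series sconst sconst_mul.
Lemma sconst_scale : scalable sconst.
Proof.
by move=> k a; apply: series_ext => -[|i w] /=; rewrite ?linearZ ?scaler0.
Qed.
HB.instance Definition _ :=
  GRing.isScalable.Build F A series *:%R sconst sconst_scale.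

(* The embedding of A<x> into its completion, see poly_series_inj. *)
Definition poly_series : P -> series := genpoly_lift sconst sletter.

HB.instance Definition _ := GRing.LRMorphism.on poly_series.

Lemma poly_series_gmonom a0 s w :
  poly_series (gmonom a0 s) w = if w == unzip1 s then gmonom a0 s else 0.
Proof.
elim: s a0 w => [|[i a1] s IH] a0 w.
  by rewrite [poly_series _]genpoly_lift_const; case: w.
rewrite /= !rmorphM /= [poly_series (gconst _ _)]genpoly_lift_const.
rewrite [poly_series (gletter _ _)]genpoly_lift_letter.
rewrite -convA conv_const -mulrA.
case: w => [|j w] /=; first by rewrite conv_nil /= mul0r mulr0.
rewrite conv_cons /= mul0r add0r eqseq_cons.
have -> : conv (sletter i \o cons j) (poly_series (gmonom a1 s)) w =
    (if j == i then gletter A i else 0) * poly_series (gmonom a1 s) w.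
  rewrite /conv big_ord_recl /= take0 drop0 eqseq_cons eqxx andbT.
  rewrite big1 ?addr0 // => k _; case: w k => [[]//|l w] k /=.
  by rewrite eqseq_cons andbF mul0r.
by rewrite IH; case: eqP => _; case: eqP => _ /=; rewrite ?mul0r ?mulr0.
Qed.

Lemma poly_series_gcomp u p w :
  gcomp u p -> poly_series p w = if w == u then p else 0.
Proof.
elim=> [|k x y [a0 [s [<- ->]]] _ IH]; first by rewrite raddf0 if_same.
rewrite linearP /= IH poly_series_gmonom.
by case: eqP => // _; rewrite scaler0 addr0.
Qed.

Lemma genpoly_sum_comp (p : P) : exists l : seq (word * P),
  (forall q, q \in l -> gcomp q.1 q.2) /\ p = \sum_(q <- l) q.2.
Proof.
elim/genpoly_ind: p => [a|i|p q [l [Hl ->]] [m [Hm ->]]|p q [l [Hl ->]] [m [Hm ->]]].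
- exists [:: ([::], gconst g a)]; rewrite big_seq1; split=> // u.
  by rewrite inE => /eqP ->; apply: gcomp_const.
- exists [:: ([:: i], gletter A i)]; rewrite big_seq1; split=> // u.
  by rewrite inE => /eqP ->; apply: gcomp_letter.
- exists (l ++ m); rewrite big_cat; split=> // u.
  by rewrite mem_cat => /orP[/Hl|/Hm].
exists [seq (u.1 ++ v.1, u.2 * v.2) | u <- l, v <- m]; split.
  by move=> x /allpairsP[[u v] [/Hl ? /Hm ? ->]]; apply: gcomp_mul.
rewrite big_allpairs_dep mulr_suml.
apply: eq_bigr => u _.
by rewrite mulr_sumr.
Qed.

(* Every generalized polynomial is the sum of its finitely many components. *)
Lemma poly_series_decomp (p : P) : exists r : seq word,
  [/\ uniq r, forall w, w \notin r -> poly_series p w = 0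
    & p = \sum_(w <- r) poly_series p w].
Proof.
have [l [Hl pE]] := genpoly_sum_comp p.
have scoef_sum w : poly_series p w = \sum_(q <- l | q.1 == w) q.2.
  transitivity (\sum_(q <- l) poly_series q.2 w).
    rewrite {1}pE raddf_sum /=; elim: {Hl pE} l => [|q l IH].
      by rewrite !big_nil.
    by rewrite !big_cons /= IH.
  rewrite [RHS]big_mkcond [LHS]big_seq [RHS]big_seq; apply: eq_bigr => q ql.
  by rewrite (poly_series_gcomp _ (Hl _ ql)) eq_sym.
exists (undup (map fst l)); split=> [|w|]; first exact: undup_uniq.
  rewrite mem_undup scoef_sum => wl; rewrite big_seq_cond big1 // => q.
  by case/andP=> ql /eqP qw; rewrite -qw map_f in wl.
under eq_bigr => w _ do rewrite scoef_sum.
rewrite (exchange_big_dep predT) //= [LHS]pE [LHS]big_seq [RHS]big_seq.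
apply: eq_bigr => q ql; rewrite big_mkcond /=.
rewrite (bigD1_seq q.1) ?undup_uniq ?mem_undup ?map_f //= eqxx big1 ?addr0 //.
by move=> w; rewrite eq_sym => /negbTE ->.
Qed.

Lemma poly_series_inj : injective poly_series.
Proof.
apply: raddf_inj => p p0; have [r [_ _ ->]] := poly_series_decomp p.
by rewrite big1 // => w _; rewrite p0.
Qed.

(* The last clause is closure under the inverse T of an invertible S. *)
Definition rationally_closed (R : series -> Prop) : Prop :=
  [/\ forall S T, R S -> R T -> R (S + T),
      forall S T, R S -> R T -> R (S * T)
    & forall S T, R S -> S * T = 1 -> T * S = 1 -> R T].

Definition rational (S : series) : Prop :=
  forall R : series -> Prop,
    (forall p, R (poly_series p)) -> rationally_closed R -> R S.

Definition word_mx n (M : 'I_g -> 'M[P]_n) w : 'M[P]_n :=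
  foldr (fun i N => M i *m N) 1%:M w.

Definition recognizable (S : series) : Prop :=
  exists (n : nat) (c : 'rV[A]_n) (b : 'cV[A]_n) (M : 'I_g -> 'M[P]_n),
    (forall i j k, gcomp [:: i] (M i j k)) /\
    forall w, S w =
      (map_mx (@gconst F A g) c *m word_mx M w *m map_mx (@gconst F A g) b) 0 0.

End GenSeries.

(* Main.v *)
Require Import Defs.
From mathcomp Require Import all_boot all_algebra.
From mathcomp Require Import boolp.

Set Implicit Arguments.
Unset Strict Implicit.
Unset Printing Implicit Defensive.

Import GRing.Theory.
Local Open Scope ring_scope.

(** Both implications follow Kleene and Schutzenberger, the coefficients lying
    in a noncommutative bimodule instead of a field.

    Recognizable series are rational.  If [S, w] = c M^w b, the entries v_i of
    the column series with coefficients M^w b solve the linear system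
    v_i = sum_j (sum_x M^x_ij) v_j + b_i, whose matrix has polynomial entries
    with zero constant term.  A series 1 - p with p of zero constant term is
    invertible (one_sub_proper_inverse), so Gaussian elimination always finds
    an invertible pivot and expresses every v_i rationally in the data
    (rational_linear_system).  Then S = sum_i c_i v_i is rational.

    Rational series are recognizable.  Constants and letters are recognizable
    by small explicit matrices, and sums by block diagonal ones.  Products and
    inverses both rest on one identity (word_mx_conv) that solves the recursion
    y(x w) = M^x (y(w) + b h(w)) by a Cauchy product with h.  The product of
    (c, M, b) and (d, N, e) is represented by the block triangular matrix with
    corner M^x b d, for which h is the second factor.  If p = (c, M, b) has zero
    constant term, the matrix M^x (1 + b c) represents the series q satisfying
    q = p + p q, for which h is q itself, so that 1 + q inverts 1 - p.  An
    arbitrary invertible S is reduced to this case by multiplying it by the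
    constant term of its inverse, which is invertible in the algebra of
    constants. *)

Section Kleene.
Variables (F : fieldType) (A : algType F) (g : nat).
Local Notation P := (genpoly A g).
Local Notation word := (seq 'I_g).
Local Notation series := (genseries A g).
Implicit Types (w : word) (S T p : series).

(** * Coefficients, and inversion of series with constant term one *)

Lemma scoefM S T w : (S * T) w = conv S T w.
Proof. by []. Qed.

Lemma scoefD S T w : (S + T) w = S w + T w.
Proof. by []. Qed.

Lemma scoefN S w : (- S) w = - S w.
Proof. by rewrite -[RHS]scaleN1r. Qed.

Lemma scoef_sum I (r : seq I) (Q : pred I) (S : I -> series) w :
  (\sum_(i <- r | Q i) S i) w = \sum_(i <- r | Q i) S i w.
Proof. exact: (big_morph (fun S => scoef S w) (fun _ _ => erefl) erefl). Qed.

Lemma proper_mulr p T : p [::] = 0 -> (p * T) [::] = 0.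
Proof. by move=> p0; rewrite scoefM conv_nil p0 mul0r. Qed.

Lemma conv_eq_drop (f h h' : word -> P) w :
  (forall v, size v <= size w -> h v = h' v)%N -> conv f h w = conv f h' w.
Proof.
by move=> e; apply: eq_bigr => i _; rewrite e // size_drop leq_subr.
Qed.

Lemma conv_eq_take (f f' h : word -> P) w :
  (forall v, size v <= size w -> f v = f' v)%N -> conv f h w = conv f' h w.
Proof.
move=> e; apply: eq_bigr => i _; rewrite e // size_take.
by case: ifP => // /ltnW.
Qed.

(** Each factor of p ^+ k consumes at least one letter. *)
Lemma proper_exp p k w : p [::] = 0 -> (size w < k)%N -> (p ^+ k) w = 0.
Proof.
move=> p0; elim: k w => // k IH w wk; rewrite exprS scoefM /conv big1 // => i _.
case: w wk i => [|x w] wk i; first by rewrite p0 mul0r.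
case: i => [[|i] lti] /=; first by rewrite p0 mul0r.
by rewrite IH ?mulr0 // size_drop (leq_ltn_trans (leq_subr _ _)).
Qed.

Lemma proper_geometric p w m : p [::] = 0 -> (size w < m)%N ->
  (\sum_(k < m) p ^+ k) w = (\sum_(k < (size w).+1) p ^+ k) w.
Proof.
move=> p0 wm; rewrite -(subnKC wm); elim: (_ - _)%N => [|d IH].
  by rewrite addn0.
rewrite addnS big_ord_recr scoefD IH proper_exp ?addr0 //.
by rewrite addSn ltnS leq_addr.
Qed.

(** The inverse is the geometric series of p: since p ^+ k vanishes on words
    shorter than k, each coefficient only sees a finite partial sum, and the
    telescoping identity for finite sums carries over. *)
Lemma one_sub_proper_inverse p : p [::] = 0 ->
  exists T, (1 - p) * T = 1 /\ T * (1 - p) = 1.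
Proof.
move=> p0.
have TP w : gcomp w ((\sum_(k < (size w).+1) p ^+ k) w) by apply: scoefP.
exists (GenSeries TP).
have one_subX w : (1 - p ^+ (size w).+1) w = (1 : series) w.
  by rewrite scoefD scoefN proper_exp // subr0.
have trunc v m : (size v < m)%N -> GenSeries TP v = (\sum_(k < m) p ^+ k) v.
  by move=> vm; rewrite /= (proper_geometric p0 vm).
have geometric m : (1 - p) * (\sum_(k < m) p ^+ k) = 1 - p ^+ m.
  by rewrite -opprB mulNr -subrX1 opprB.
have comm m : (1 - p) * (\sum_(k < m) p ^+ k) = (\sum_(k < m) p ^+ k) * (1 - p).
  apply: commr_sum => k _; apply/commr_sym/commrB; first exact: commr1.
  exact/commr_sym/commrX.
split; apply: series_ext => w; rewrite scoefM -(one_subX w) -geometric.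
  rewrite (@conv_eq_drop _ _ (\sum_(k < (size w).+1) p ^+ k)) // => v vw.
  exact: trunc.
rewrite comm (@conv_eq_take _ (\sum_(k < (size w).+1) p ^+ k)) // => v vw.
exact: trunc.
Qed.

(** * The rational closure *)

Lemma rational_poly (p : P) : rational (poly_series p).
Proof. by move=> R Rp _. Qed.

Lemma rational_is_closed : rationally_closed (@rational F A g).
Proof.
split=> [S T RS RT|S T RS RT|S T RS ST TS] R Rp Rc; case: (Rc) => RD RM RV.
- by apply: RD; [apply: RS | apply: RT].
- by apply: RM; [apply: RS | apply: RT].
- by apply: RV ST TS; apply: RS.
Qed.

Lemma rational_sum n (S : 'I_n -> series) :
  (forall i, rational (S i)) -> rational (\sum_i S i).
Proof.
move=> RS; have [RD _ _] := rational_is_closed.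
apply: big_ind => //; rewrite -(raddf0 (@poly_series F A g)).
exact: rational_poly.
Qed.

Lemma rational_one_sub S : rational S -> rational (1 - S).
Proof.
move=> RS; have [RD RM _] := rational_is_closed.
apply: RD; first by rewrite -(rmorph1 (@poly_series F A g)); apply: rational_poly.
rewrite -mulN1r -(rmorphN1 (@poly_series F A g)).
exact: RM (rational_poly _) RS.
Qed.

Lemma rational_const (a : A) : rational (sconst g a).
Proof.
have <- : poly_series (gconst g a) = sconst g a by exact: genpoly_lift_const.
exact: rational_poly.
Qed.

(** Elimination of the unknown v ord0: its pivot 1 - M ord0 ord0 is invertible
    with rational inverse T, and substituting v ord0 in the other equations
    leaves a smaller system whose coefficients are still rational and still
    without constant term. *)
Lemma rational_linear_system n (M : 'I_n -> 'I_n -> series) (b v : 'I_n -> series) :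
  (forall i j, rational (M i j)) -> (forall i j, M i j [::] = 0) ->
  (forall i, rational (b i)) ->
  (forall i, v i = \sum_j M i j * v j + b i) ->
  forall i, rational (v i).
Proof.
have [RD RM RV] := rational_is_closed.
elim: n => [|n IH] in M b v *; first by move=> _ _ _ _ [].
move=> RMij M0 Rb vE.
have [T [invT Tinv]] := one_sub_proper_inverse (M0 ord0 ord0).
have RT : rational T by apply: RV invT Tinv; apply: rational_one_sub.
pose c := \sum_j M ord0 (lift ord0 j) * v (lift ord0 j) + b ord0.
have v0E : v ord0 = T * c.
  rewrite -[v ord0]mul1r -Tinv -mulrA; congr (_ * _).
  by rewrite mulrBl mul1r [X in X - _]vE big_ord_recl addrC !addrA addNr add0r.
have Rv i : rational (v (lift ord0 i)).
  pose M' i j := M (lift ord0 i) ord0 * (T * M ord0 (lift ord0 j)) +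
                 M (lift ord0 i) (lift ord0 j).
  pose b' i := M (lift ord0 i) ord0 * (T * b ord0) + b (lift ord0 i).
  apply: (IH M' b' (fun i => v (lift ord0 i))) => [k j|k j|k|k].
  - by apply: (RD) => //; apply: (RM) => //; apply: RM.
  - by rewrite scoefD M0 proper_mulr ?addr0.
  - by apply: (RD) => //; apply: (RM) => //; apply: RM.
  rewrite vE big_ord_recl v0E /c /b' !mulrDr !mulr_sumr.
  rewrite -!addrA [in RHS]addrCA [in LHS]addrCA; congr (_ + _).
  rewrite !addrA; congr (_ + _); rewrite -big_split /=; apply: eq_bigr => j _.
  by rewrite mulrDl !mulrA.
move=> i; case: (unliftP ord0 i) => [j|] -> //.
rewrite v0E; apply: (RM) => //; apply: (RD) => //; apply: rational_sum => j.
exact: RM.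
Qed.

(** * Homogeneous matrices *)

(** Closure of these matrix spaces under block assembly and product is what
    makes the matrices built below admissible in a representation. *)
Definition mxcomp m n (w : word) (M : 'M[P]_(m, n)) : Prop :=
  forall i j, gcomp w (M i j).

Lemma mxcomp0 m n w : mxcomp w (0 : 'M[P]_(m, n)).
Proof. by move=> i j; rewrite mxE; constructor. Qed.

Lemma mxcompD m n w (M N : 'M[P]_(m, n)) :
  mxcomp w M -> mxcomp w N -> mxcomp w (M + N).
Proof. by move=> HM HN i j; rewrite mxE; apply: lspanD; [apply: HM | apply: HN]. Qed.

Lemma mxcomp_mul m n r u v (M : 'M[P]_(m, n)) (N : 'M[P]_(n, r)) :
  mxcomp u M -> mxcomp v N -> mxcomp (u ++ v) (M *m N).
Proof.
by move=> HM HN i j; rewrite mxE; apply: lspan_sum => k; apply: gcomp_mul.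
Qed.

Lemma mxcomp_mulr m n r u (M : 'M[P]_(m, n)) (N : 'M[P]_(n, r)) :
  mxcomp u M -> mxcomp [::] N -> mxcomp u (M *m N).
Proof. by move=> HM HN; rewrite -[u]cats0; apply: mxcomp_mul. Qed.

Lemma mxcomp_row m n1 n2 w (M : 'M[P]_(m, n1)) (N : 'M[P]_(m, n2)) :
  mxcomp w M -> mxcomp w N -> mxcomp w (row_mx M N).
Proof. by move=> HM HN i j; rewrite mxE; case: split. Qed.

Lemma mxcomp_col m1 m2 n w (M : 'M[P]_(m1, n)) (N : 'M[P]_(m2, n)) :
  mxcomp w M -> mxcomp w N -> mxcomp w (col_mx M N).
Proof. by move=> HM HN i j; rewrite mxE; case: split. Qed.

Lemma mxcomp_word n (M : 'I_g -> 'M[P]_n) w :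
  (forall i, mxcomp [:: i] (M i)) -> mxcomp w (word_mx M w).
Proof.
move=> HM; elim: w => [|x w IH] /=; last exact: (mxcomp_mul (HM x) IH).
move=> i j; rewrite mxE; case: (i == j); last by constructor.
by rewrite -(rmorph1 (@gconst F A g)); apply: gcomp_const.
Qed.

Lemma mxcomp_const m n (a : 'M[A]_(m, n)) : mxcomp [::] (map_mx (@gconst F A g) a).
Proof. by move=> i j; rewrite mxE; apply: gcomp_const. Qed.

(** The algebra morphism killing the letters: on polynomials without letters it
    inverts the embedding of the constants. *)
Definition genpoly_coef0 : P -> A :=
  genpoly_lift (idfun : {lrmorphism A -> A}) (fun=> 0).

Lemma genpoly_coef0K (p : P) : gcomp [::] p -> gconst g (genpoly_coef0 p) = p.
Proof.
rewrite /genpoly_coef0; elim=> [|k u v [a [s [/eqP]]]]; first by rewrite !raddf0.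
case: s => // _ -> _ IH; rewrite linearP /= genpoly_lift_const.
by rewrite linearP /= IH.
Qed.

Lemma mxcomp_constP m n (c : 'M[P]_(m, n)) : mxcomp [::] c ->
  exists a : 'M[A]_(m, n), c = map_mx (@gconst F A g) a.
Proof.
move=> cP; exists (map_mx genpoly_coef0 c); apply/matrixP => i j.
by rewrite !mxE genpoly_coef0K.
Qed.

(** A representation whose outer vectors have entries in the polynomials without
    letters, rather than in the algebra itself: rows, columns and transition
    matrices are then treated uniformly by mxcomp, also when the new rows and
    columns are products of the old ones. *)
Definition represents (S : series) n (c : 'rV[P]_n) (b : 'cV[P]_n)
    (M : 'I_g -> 'M[P]_n) : Prop :=
  [/\ mxcomp [::] c, mxcomp [::] b, forall i, mxcomp [:: i] (M i)
    & forall w, S w = (c *m (word_mx M w *m b)) 0 0].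

Lemma recognizableP S : recognizable S <->
  exists n (c : 'rV[P]_n) (b : 'cV[P]_n) (M : 'I_g -> 'M[P]_n), represents S c b M.
Proof.
split=> [[n [c [b [M [HM HS]]]]]|[n [c [b [M [Hc Hb HM HS]]]]]].
  exists n, (map_mx (@gconst F A g) c), (map_mx (@gconst F A g) b), M.
  by split=> // [||w]; try exact: mxcomp_const; rewrite HS mulmxA.
have [[a ca] [d bd]] := (mxcomp_constP Hc, mxcomp_constP Hb).
by exists n, a, d, M; split=> // w; rewrite -ca -bd HS mulmxA.
Qed.

Lemma word_mx_cons_mul n m (M : 'I_g -> 'M[P]_n) x w (b : 'M[P]_(n, m)) :
  word_mx M (x :: w) *m b = M x *m (word_mx M w *m b).
Proof. by rewrite mulmxA. Qed.

(** * Recognizable series are rational *)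

(** The columns M^w b assemble into series v_i that solve a proper linear
    system, because reading one letter of w costs one multiplication by M. *)
Lemma recognizable_rational S : recognizable S -> rational S.
Proof.
case/recognizableP=> n [c [b [M [Hc Hb HM HS]]]].
have [RD RM _] := rational_is_closed.
have vP i w : gcomp w ((word_mx M w *m b) i 0).
  exact: (mxcomp_mulr (mxcomp_word w HM) Hb).
pose v i := GenSeries (vP i).
have Rv : forall i, rational (v i).
  pose N i j : series := \sum_x poly_series (M x i j).
  have Ncoef i j w : N i j w = \sum_x if w == [:: x] then M x i j else 0.
    by rewrite scoef_sum; apply: eq_bigr => x _; apply: (poly_series_gcomp _ (HM x i j)).
  apply: (@rational_linear_system _ N (fun i => sconst g (genpoly_coef0 (b i 0)))).
  - by move=> i j; apply: rational_sum => x; apply: rational_poly.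
  - by move=> i j; rewrite Ncoef big1.
  - by move=> i; apply: rational_const.
  move=> i; apply: series_ext => w; rewrite scoefD scoef_sum.
  case: w => [|x w].
    rewrite /= mul1mx genpoly_coef0K // big1 ?add0r // => j _.
    by rewrite conv_nil Ncoef big1 ?mul0r.
  rewrite /= addr0 -mulmxA mxE; apply: eq_bigr => j _.
  rewrite conv_cons Ncoef big1 // mul0r add0r /conv big_ord_recl.
  rewrite /= take0 drop0 Ncoef (bigD1 x) //= eqxx big1 => [|y yx]; last first.
    by rewrite eqseq_cons eq_sym (negPf yx).
  rewrite addr0 big1 ?addr0 // => k _; rewrite Ncoef big1 ?mul0r // => y _.
  by case: w k => [[]//|z w] k /=; rewrite eqseq_cons andbF.
suff -> : S = \sum_j sconst g (genpoly_coef0 (c 0 j)) * v j.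
  by apply: rational_sum => j; apply: RM (rational_const _) (Rv j).
apply: series_ext => w; rewrite HS mxE scoef_sum; apply: eq_bigr => j _.
by rewrite scoefM conv_const genpoly_coef0K.
Qed.

(** * Closure of recognizable series under rational operations *)

Lemma recognizable_const (a : A) : recognizable (sconst g a).
Proof.
exists 1%N, a%:M, 1%:M, (fun=> 0); split=> [i j k|[|x w]].
- by rewrite mxE; constructor.
- by rewrite /= mulmx1 map_scalar_mx map_mx1 mulmx1 mxE.
- by rewrite /= mul0mx mulmx0 mul0mx mxE.
Qed.

(** Two states, with a single transition from the initial to the final one. *)
Lemma recognizable_letter (i : 'I_g) : recognizable (sletter A i).
Proof.
pose l x : 'M[P]_1 := if x == i then (gletter A i)%:M else 0.
pose M x : 'M[P]_(1 + 1) := block_mx 0 (l x) 0 0.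
have mxcomp1 : mxcomp [::] (1%:M : 'M[P]_1).
  by rewrite -(map_mx1 (@gconst F A g)); apply: mxcomp_const.
apply/recognizableP; exists (1 + 1)%N, (row_mx 1%:M 0), (col_mx 0 1%:M), M.
split.
- by apply: mxcomp_row => //; apply: mxcomp0.
- by apply: mxcomp_col => //; apply: mxcomp0.
- move=> x; apply: mxcomp_col; apply: mxcomp_row; try exact: mxcomp0.
  rewrite /l => j k; case: eqP => [->|_]; rewrite mxE; last exact: scoef_zeroP.
  by rewrite !ord1 eqxx; apply: gcomp_letter.
case=> [|x [|y w]].
- by rewrite mul1mx mul_row_col mul0mx mulmx0 addr0 mxE.
- rewrite word_mx_cons_mul mul1mx mul_block_col !mul0mx !mulmx1 addr0 add0r.
  rewrite mul_row_col mul1mx mul0mx addr0 /l /= eqseq_cons andbT.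
  by case: (x == i); rewrite mxE.
have MM0 : M x *m M y = 0.
  by rewrite /M mulmx_block !mulmx0 !mul0mx !addr0; apply: block_mx0.
rewrite !word_mx_cons_mul (mulmxA (M x)) MM0 mul0mx mulmx0 mxE /=.
by rewrite eqseq_cons andbF.
Qed.

Lemma recognizableD S T : recognizable S -> recognizable T -> recognizable (S + T).
Proof.
case/recognizableP=> n [c [b [M [Hc Hb HM HS]]]].
case/recognizableP=> m [d [e [N [Hd He HN HT]]]].
apply/recognizableP; exists (n + m)%N, (row_mx c d), (col_mx b e).
exists (fun x => block_mx (M x) 0 0 (N x)); split.
- exact: mxcomp_row.
- exact: mxcomp_col.
- by move=> i; do [apply: mxcomp_col; apply: mxcomp_row] => //; apply: mxcomp0.
move=> w; suff -> : word_mx (fun x => block_mx (M x) 0 0 (N x)) w =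
    block_mx (word_mx M w) 0 0 (word_mx N w).
  by rewrite mul_block_col !mul0mx addr0 add0r mul_row_col mxE -HS -HT.
elim: w => [|x w IH]; first by rewrite /= -scalar_mx_block.
by rewrite /= IH mulmx_block !mulmx0 !mul0mx !addr0 !add0r.
Qed.

(** Unrolling the recursion for y on the word w inserts one copy of b h(v) for
    each nonempty prefix of w, v being the remaining suffix; this is the Cauchy
    product of the series (c, M, b) with h, except for the empty prefix, whose
    contribution (c b) h(w) is therefore added on the left. *)
Lemma word_mx_conv n (c : 'rV[P]_n) (b g0 : 'cV[P]_n) (M : 'I_g -> 'M[P]_n)
    (h : word -> P) (y : word -> 'cV[P]_n) :
  y [::] = g0 -> (forall x w, y (x :: w) = M x *m (y w + b *m (h w)%:M)) ->
  forall w, (c *m y w) 0 0 + (c *m b) 0 0 * h w =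
    (c *m (word_mx M w *m g0)) 0 0 +
    conv (fun u => (c *m (word_mx M u *m b)) 0 0) h w.
Proof.
move=> y0 yS w; elim: w c => [|x w IH] c.
  by rewrite conv_nil y0 /= !mul1mx.
rewrite conv_cons [word_mx M [::] *m b]mul1mx [RHS]addrCA addrC; congr (_ + _).
rewrite word_mx_cons_mul mulmxA.
have -> : (fun u => (c *m (word_mx M u *m b)) 0 0) \o cons x =
    (fun u => (c *m M x *m (word_mx M u *m b)) 0 0).
  by apply/funext => u; rewrite /= !mulmxA.
rewrite -IH yS !mulmxA mulmxDr mxE mulmxA; congr (_ + _).
by rewrite [LHS]mxE big_ord1 [X in _ * X]mxE eqxx mulr1n.
Qed.

(** In the block triangular matrix K, the lower half of K^w (0, e) is the state
    N^w e of the second factor, while the upper half is fed the value T w of the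
    second factor through b.  The row c b d accounts for the empty prefix. *)
Lemma recognizableM S T : recognizable S -> recognizable T -> recognizable (S * T).
Proof.
case/recognizableP=> n [c [b [M [Hc Hb HM HS]]]].
case/recognizableP=> m [d [e [N [Hd He HN HT]]]].
pose K x := block_mx (M x) (M x *m b *m d) 0 (N x).
pose z w := word_mx K w *m col_mx 0 e.
have zE w : z w = col_mx (usubmx (z w)) (word_mx N w *m e).
  rewrite -[LHS]vsubmxK; congr col_mx; elim: w => [|x w IH].
    by rewrite /z /= !mul1mx col_mxKd.
  rewrite {1}/z word_mx_cons_mul -/(z w) -[z w]vsubmxK IH mul_block_col.
  by rewrite col_mxKd mul0mx add0r word_mx_cons_mul.
apply/recognizableP; exists (n + m)%N, (row_mx c (c *m b *m d)), (col_mx 0 e), K.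
split.
- by apply: mxcomp_row => //; do 2!apply: mxcomp_mulr => //.
- by apply: mxcomp_col => //; apply: mxcomp0.
- move=> x; apply: mxcomp_col; apply: mxcomp_row => //; last exact: mxcomp0.
  by do 2!apply: mxcomp_mulr => //.
move=> w; rewrite -/(z w) zE mul_row_col [RHS]mxE -[_ *m d *m _]mulmxA.
have e11 (a a' : 'M[P]_1) : (a *m a') 0 0 = a 0 0 * a' 0 0.
  by rewrite mxE big_ord1.
rewrite e11 -HT (@word_mx_conv _ c b 0 M T (fun u => usubmx (z u))).
- by rewrite !mulmx0 mxE add0r; apply: eq_bigr => k _; rewrite HS.
- by rewrite /z /= mul1mx col_mxKu.
move=> x u; rewrite {1}/z word_mx_cons_mul -/(z u) zE mul_block_col col_mxKu.
rewrite mulmxDr col_mxKu -!mulmxA; congr (_ + _ *m (_ *m _)).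
by apply/matrixP => k l; rewrite !ord1 [RHS]mxE eqxx mulr1n HT.
Qed.

(** With K^x = M^x (1 + b c) a run may, after every letter, either go on in the
    same copy of p or close it and open a new one: q = (c, K, b) is the sum
    of the powers p ^+ k with k positive.  As c b is the zero constant term of
    p, closing a copy at the very end adds nothing. *)
Lemma proper_recognizable_inverse p : p [::] = 0 -> recognizable p ->
  exists2 T, recognizable T & (1 - p) * T = 1.
Proof.
move=> p0 /recognizableP[n [c [b [M [Hc Hb HM Hp]]]]].
pose K x := M x + M x *m b *m c.
pose q_ w := (c *m (word_mx K w *m b)) 0 0.
have HK x : mxcomp [:: x] (K x).
  by apply: mxcompD => //; do 2!apply: mxcomp_mulr => //.
have qP w : gcomp w (q_ w).
  exact: (mxcomp_mul Hc (mxcomp_mulr (mxcomp_word w HK) Hb)).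
pose q := GenSeries qP.
have recq : recognizable q by apply/recognizableP; exists n, c, b, K; split.
have cb0 : (c *m b) 0 0 = 0 by rewrite -p0 Hp mul1mx.
have qE : q = p + p * q.
  apply: series_ext => w.
  have := @word_mx_conv _ c b b M q (fun u => word_mx K u *m b) _ _ w.
  rewrite cb0 mul0r addr0 -Hp => conv_q.
  rewrite [LHS]conv_q ?[word_mx K [::] *m b]mul1mx //; last first.
    move=> x u; rewrite word_mx_cons_mul mulmxDl mulmxDr -!mulmxA.
    congr (_ + _ *m (_ *m _)).
    by apply/matrixP => k l; rewrite !ord1 [RHS]mxE eqxx mulr1n.
  by rewrite scoefD scoefM; congr (_ + _); apply: eq_bigr => k _; rewrite Hp.
exists (1 + q).
  by apply: recognizableD => //; apply: (recognizable_const 1).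
by rewrite mulrBl mul1r mulrDr mulr1 -qE addrK.
Qed.

(** Multiplying S by the constant term a of T makes its constant term 1, so
    a S = 1 - p with p proper has a recognizable right inverse U.  Since a has
    the constant term s of S as inverse, S U = s and T = U a. *)
Lemma recognizable_inverse S T :
  recognizable S -> S * T = 1 -> T * S = 1 -> recognizable T.
Proof.
move=> RS ST TS; pose a := genpoly_coef0 (T [::]); pose s := genpoly_coef0 (S [::]).
have aE : gconst g a = T [::] by apply: genpoly_coef0K; apply: scoefP.
have sE : gconst g s = S [::] by apply: genpoly_coef0K; apply: scoefP.
have sa : sconst g s * sconst g a = 1.
  rewrite -rmorphM; apply: series_ext => -[|//] /=.
  by rewrite rmorphM /= sE aE -conv_nil -scoefM ST.
have p0 : (1 - sconst g a * S) [::] = 0.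
  by rewrite scoefD scoefN [X in - X]conv_const aE -conv_nil -scoefM TS subrr.
have [|U RU] := proper_recognizable_inverse p0.
  apply: recognizableD; first exact: (recognizable_const 1).
  rewrite -mulN1r -(rmorphN1 (@sconst F A g)).
  exact: recognizableM (recognizable_const _) (recognizableM (recognizable_const _) RS).
rewrite opprB addrC subrK => aSU.
have SU : S * U = sconst g s.
  by rewrite -[S * U]mul1r -sa -mulrA (mulrA (sconst g a)) aSU mulr1.
have <- : U * sconst g a = T.
  by rewrite -[U]mul1r -TS -(mulrA T) SU -mulrA sa mulr1.
exact: recognizableM (recognizable_const _).
Qed.

Lemma recognizable_poly (p : P) : recognizable (poly_series p).
Proof.
elim/genpoly_ind: p => [a|i|p q Rp Rq|p q Rp Rq].
- by rewrite [poly_series _]genpoly_lift_const; apply: recognizable_const.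
- by rewrite [poly_series _]genpoly_lift_letter; apply: recognizable_letter.
- by rewrite raddfD; apply: recognizableD.
- by rewrite rmorphM; apply: recognizableM.
Qed.

End Kleene.

Theorem theorem3p8 (F : fieldType) (charF : [pchar F] =i pred0)
  (A : algType F) (centralA : central A) (g : nat) (S : genseries A g) :
  rational S <-> recognizable S.
Proof.
split; last exact: recognizable_rational.
apply; first exact: recognizable_poly.
split; [exact: recognizableD | exact: recognizableM | exact: recognizable_inverse].
Qed.
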